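(* Let $M\in\mathrm{M}_n(\mathbb{K})$ and let $\mathbb{K}^n=V_1\oplus\cdots\oplus V_t$ where each $V_i$ is a $\mathbb{K}$-subspace with $V_iM^t\subseteq V_i$ such that the endomorphism $v\mapsto vM^t$ of $V_i$ is cyclic with minimal polynomial $\Theta_i\in\mathbb{K}[x]$; put $d_i=\deg\Theta_i$. Let $P\in\mathbb{L}[x]$ and $\mathcal{C}=\ker(P(M))=\{c\in\mathbb{L}^n : cP(M)^t=0\}$. For each $i$ let $\mathcal{C}_i\subseteq\mathbb{L}^{d_i}$ be the $\Theta_i$-polynomial code with generator polynomial $\Theta_i/\gcd(P,\Theta_i)$, and let $\Lambda=\{i : \gcd(P,\Theta_i)\neq1\}$ (gcd taken monic in $\mathbb{L}[x]$). Then: $k_i:=\dim_{\mathbb{L}}\mathcal{C}_i=\deg\gcd(P,\Theta_i)$ for all $i$, and $M_{r_i}(\mathcal{C}_i)\le\deg(\Theta_i)-\deg\gcd(P,\Theta_i)+r_i$ for all $r_i\in\{1,\dots,k_i\}$; $k:=\dim_{\mathbb{L}}\mathcal{C}=\sum_{i\in\Lambda}\deg\gcd(P,\Theta_i)$; and for all $r\in\{1,\dots,k\}$, $$M_r(\mathcal{C})=\min_{\substack{\sum_{i\in\Lambda}r_i=r\\ r_i\in\{0,\dots,k_i\}}}\sum_{i\in\Lambda}M_{r_i}(\mathcal{C}_i)\le\min_{\substack{\sum_{i\in\Lambda}r_i=r\\ r_i\in\{0,\dots,k_i\}}}\Big(\sum_{i\in\Lambda,\ r_i\neq0}(\deg\Theta_i-\deg\gcd(P,\Theta_i))\Big)+r.$$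 In particular $M_1(\mathcal{C})=\min_{i\in\Lambda}M_1(\mathcal{C}_i)$ and $M_k(\mathcal{C})=\sum_{i\in\Lambda}M_{k_i}(\mathcal{C}_i)\le\sum_{i\in\Lambda}\deg\Theta_i$.
   Context: Let $\mathbb{L}/\mathbb{K}$ be a field extension of finite degree $m$, and $n\ge 1$ an integer with $m\ge n$ (standing assumption). Vectors are row vectors. Fix a $\mathbb{K}$-basis $\mathcal{B}$ of $\mathbb{L}$; for $c=(c_1,\dots,c_n)\in\mathbb{L}^n$ let $M_{\mathcal{B}}(c)$ be the $m\times n$ matrix over $\mathbb{K}$ whose $j$-th column is the coordinate vector of $c_j$ in $\mathcal{B}$; $\mathrm{Rsupp}(c)\subseteq\mathbb{K}^n$ is its $\mathbb{K}$-row space and $\mathrm{wt}_R(c)=\dim_{\mathbb{K}}\mathrm{Rsupp}(c)$. For an $\mathbb{L}$-subspace $\mathcal{D}$, $\mathrm{Rsupp}(\mathcal{D})$ is the $\mathbb{K}$-span of all $\mathrm{Rsupp}(d)$, $d\in\mathcal{D}$, and $\mathrm{wt}_R(\mathcal{D})=\dim_{\mathbb{K}}\mathrm{Rsupp}(\mathcal{D})$. A linear $[n,k]$ code is a $k$-dimensional $\mathbb{L}$-subspace $\mathcal{C}\subseteq\mathbb{L}^n$; $M_r(\mathcal{C})=\min\{\mathrm{wt}_R(\mathcal{D}):\mathcal{D}\subseteq\mathcal{C},\dim_{\mathbb{L}}\mathcal{D}=r\}$ for $1\le r\le k$, and $M_0(\mathcal{C})=0$. An endomorphism $u$ of a vector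 space $V$ of dimension $d$ is cyclic if there is $v$ with $(v,u(v),\dots,u^{d-1}(v))$ a basis. For a monic $\Theta=x^d+a_{d-1}x^{d-1}+\dots+a_0\in\mathbb{K}[x]$, its companion matrix $C_\Theta\in\mathrm{M}_d(\mathbb{K})$ has ones on the subdiagonal, last column $(-a_0,\dots,-a_{d-1})^t$, and zeros elsewhere. The $\Theta$-polynomial code with generator polynomial $g$ (a monic divisor of $\Theta$ in $\mathbb{L}[x]$) is $\{w\,g(C_\Theta)^tQ(C_\Theta)^t : Q\in\mathbb{L}[x]\}\subseteq\mathbb{L}^d$ with $w=(1,0,\dots,0)$; equivalently, the set of coefficient vectors $(b_0,\dots,b_{d-1})$ of the polynomials of degree $<d$ representing elements of the ideal $(\bar g)$ of $\mathbb{L}[x]/(\Theta)$. *)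

(* Defs.v *)
From HB Require Import structures.
From mathcomp Require Import all_boot all_order all_algebra all_field.
From mathcomp Require Import boolp.
Set Implicit Arguments.
Unset Strict Implicit.
Unset Printing Implicit Defensive.
Import Order.TTheory GRing.Theory.
Local Open Scope ring_scope.

Lemma nat_min_ex (P : nat -> Prop) :
  (exists w, P w) -> exists w, `[< P w >].
Proof. by case=> w hw; exists w; apply/asboolP. Qed.

Definition nat_min (P : nat -> Prop) : nat :=
  match pselect (exists w, P w) with
  | left h => ex_minn (nat_min_ex h)
  | right _ => 0%N
  end.

Definition mxpeval (R : comNzRingType) (d : nat) (A : 'M[R]_d) (p : {poly R})
  : 'M[R]_d := \sum_(i < size p) p`_i *: A ^+ i.

Section RankMetric.
Variables (K : fieldType) (L : fieldExtType K).
Local Notation m := (\dim {: L}).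

Definition MB (B : m.-tuple L) (n : nat) (c : 'rV[L]_n) : 'M[K]_(m, n) :=
  \matrix_(i < m, j < n) coord B i (c 0 j).

Definition wtR_vec (B : m.-tuple L) n (c : 'rV[L]_n) : nat := \rank (MB B c).

(* wt_R(D) for the L-subspace D (row space of a matrix over L):
   dim_K of the K-span of all Rsupp(d), d in D, i.e. the dimension of the
   smallest K-subspace of K^n containing every Rsupp(d). *)
Definition wtR (B : m.-tuple L) p n (D : 'M[L]_(p, n)) : nat :=
  nat_min (fun w => exists S : 'M[K]_n,
     \rank S = w /\ forall d : 'rV[L]_n, (d <= D)%MS -> (MB B d <= S)%MS).

Definition Mr (B : m.-tuple L) p n (C : 'M[L]_(p, n)) (r : nat) : nat :=
  if r == 0%N then 0%N else
  nat_min (fun w => exists D : 'M[L]_n,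
     \rank D = r /\ (D <= C)%MS /\ wtR B D = w).

Definition liftp (p : {poly K}) : {poly L} := map_poly (in_alg L) p.
End RankMetric.

Section Restr.
Variables (K : fieldType) (n : nat).

Definition restr_cyclic (V A : 'M[K]_n) : Prop :=
  exists v : 'rV[K]_n, (v <= V)%MS /\
    let X := \matrix_(j < \rank V) (v *m A ^+ j) in
    row_free X /\ (X == V)%MS.

Definition restr_minpoly (V A : 'M[K]_n) (Theta : {poly K}) : Prop :=
  Theta \is monic /\ V *m mxpeval A Theta = 0 /\
  forall q : {poly K}, V *m mxpeval A q = 0 -> Theta %| q.
End Restr.

Section PolyCode.
Variable (L : fieldType).

(* monic gcd (gcd(0,0) = 0) *)
Definition mgcd (p q : {poly L}) : {poly L} :=
  (lead_coef (gcdp p q))^-1 *: gcdp p q.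

Definition compmx (Theta : {poly L}) : 'M[L]_((size Theta).-1) :=
  \matrix_(i < (size Theta).-1, j < (size Theta).-1)
    if (j == ((size Theta).-1).-1 :> nat) then - Theta`_i
    else (i == j.+1 :> nat)%:R.

Definition e0 (d : nat) : 'rV[L]_d := \row_(j < d) (j == 0%N :> nat)%:R.

Definition polycode (Theta g : {poly L}) (c : 'rV[L]_((size Theta).-1)) : Prop :=
  exists Q : {poly L},
    c = e0 _ *m (mxpeval (compmx Theta) g)^T *m (mxpeval (compmx Theta) Q)^T.
End PolyCode.
Arguments polycode {L} Theta g c.

(* Main.v *)
(* By linearity over K, wt_R(D) is the least dimension of a K-subspace S of K^n
   such that D lies in S (x) L, so weights are preserved by K-linear
   isomorphisms.  A cyclic vector v_i identifies V_i with K^(d_i) so that M^t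
   becomes the transposed companion matrix of Theta_i, and ker P becomes the set
   of f modulo Theta_i with Theta_i | f P, i.e. Theta_i / gcd(P, Theta_i) | f:
   this is C_i.  Thus C is the direct sum of the images of the C_i.
   A sum of optimal subcodes of the C_i gives one inequality for M_r(C).  For the
   other, filter a subcode D and a space S supporting it along the flag of
   partial sums of the V_i: the graded pieces of S support those of D. *)
Require Import Defs.
From HB Require Import structures.
From mathcomp Require Import all_boot all_order all_algebra all_field.
From mathcomp Require Import boolp.
Set Implicit Arguments.
Unset Strict Implicit.
Unset Printing Implicit Defensive.
Import Order.TTheory GRing.Theory.
Local Open Scope ring_scope.

(** * Polynomials in a matrix and Krylov matrices *)

Section Mxpeval.
Variable R : comNzRingType.

(** In positive size the algebra of [mxpeval] is that of the ring morphism [horner_mx A]; size 0,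
    where all matrices are equal, is split off in the lemmas below. *)
Lemma mxpeval_horner d (A : 'M[R]_d.+1) p : mxpeval A p = horner_mx A p.
Proof.
rewrite -[in RHS](coefK p) poly_def raddf_sum; apply: eq_bigr => i _ /=.
by rewrite linearZ /= rmorphXn /= horner_mx_X.
Qed.

Lemma mxpevalD d (A : 'M[R]_d) p q : mxpeval A (p + q) = mxpeval A p + mxpeval A q.
Proof.
by case: d A => [|d] A; [rewrite !thinmx0 | rewrite !mxpeval_horner rmorphD].
Qed.

Lemma mxpevalB d (A : 'M[R]_d) p q : mxpeval A (p - q) = mxpeval A p - mxpeval A q.
Proof.
by case: d A => [|d] A; [rewrite !thinmx0 | rewrite !mxpeval_horner rmorphB].
Qed.

Lemma mxpevalXn d (A : 'M[R]_d) k : mxpeval A 'X^k = A ^+ k.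
Proof.
case: d A => [|d] A; first by rewrite !thinmx0.
by rewrite mxpeval_horner rmorphXn /= horner_mx_X.
Qed.

Lemma mxpevalM d (A : 'M[R]_d) p q :
  mxpeval A (p * q) = mxpeval A p *m mxpeval A q.
Proof.
by case: d A => [|d] A; [rewrite !thinmx0 | rewrite !mxpeval_horner rmorphM].
Qed.

Lemma mxpevalE d (A : 'M[R]_d) (p : {poly R}) k :
  (size p <= k)%N -> mxpeval A p = \sum_(i < k) p`_i *: A ^+ i.
Proof.
move=> le_pk; rewrite /mxpeval (big_ord_widen _ (fun i => p`_i *: A ^+ i) le_pk).
rewrite [RHS](bigID (fun i : 'I_k => (i < size p)%N)) /= [X in _ + X]big1 ?addr0 //.
by move=> i; rewrite -leqNgt => le_pi; rewrite nth_default // scale0r.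
Qed.

Lemma expmx_intertwine m n (A : 'M[R]_m) (X : 'M_(m, n)) (B : 'M_n) k :
  A *m X = X *m B -> A ^+ k *m X = X *m B ^+ k.
Proof.
move=> AX; elim: k => [|k IHk]; first by rewrite !expr0 mul1mx mulmx1.
by rewrite !exprSr -!mulmxE -mulmxA AX !mulmxA IHk.
Qed.

Lemma mxpeval_intertwine m n (A : 'M[R]_m) (X : 'M_(m, n)) (B : 'M_n) p :
  A *m X = X *m B -> mxpeval A p *m X = X *m mxpeval B p.
Proof.
move=> AX; rewrite mulmx_suml mulmx_sumr; apply: eq_bigr => i _.
by rewrite -scalemxAl -scalemxAr (expmx_intertwine i AX).
Qed.

Lemma trmxX n (A : 'M[R]_n) k : (A ^+ k)^T = A^T ^+ k.
Proof.
elim: k => [|k IHk]; first by rewrite !expr0 trmx1.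
by rewrite exprS exprSr trmx_mul IHk.
Qed.

Lemma trmx_mxpeval n (A : 'M[R]_n) p : (mxpeval A p)^T = mxpeval A^T p.
Proof.
rewrite /mxpeval raddf_sum; apply: eq_bigr => i _ /=.
by rewrite linearZ /= trmxX.
Qed.

(** The matrix of the map f -> v f(A) on polynomials of degree < d, in the basis 1, x, ...,
    x^(d-1). *)
Definition krylov d n (A : 'M[R]_n) (v : 'rV_n) : 'M_(d, n) :=
  \matrix_(j < d) (v *m A ^+ j).

Lemma mul_krylov d n (A : 'M[R]_n) (v : 'rV_n) (u : 'rV_d) :
  u *m krylov d A v = v *m mxpeval A (rVpoly u).
Proof.
rewrite mulmx_sum_row (mxpevalE A (size_poly _ _)) mulmx_sumr.
apply: eq_bigr => i _; rewrite rowK coef_rVpoly_ord -scalemxAr //.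
Qed.

End Mxpeval.

Lemma map_mxX (R S : comNzRingType) (f : {rmorphism R -> S}) n (A : 'M_n) k :
  map_mx f (A ^+ k) = map_mx f A ^+ k.
Proof.
elim: k => [|k IHk]; first by rewrite !expr0 map_mx1.
by rewrite !exprS map_mxM IHk.
Qed.

Lemma map_mxpeval (R S : comNzRingType) (f : {rmorphism R -> S}) n (A : 'M_n) p :
  map_mx f (mxpeval A p) = mxpeval (map_mx f A) (map_poly f p).
Proof.
rewrite (mxpevalE _ (size_poly _ _)) /mxpeval raddf_sum; apply: eq_bigr => i _ /=.
by rewrite map_mxZ map_mxX coef_map.
Qed.

Lemma map_krylov (R S : comNzRingType) (f : {rmorphism R -> S}) d n
    (A : 'M_n) (v : 'rV_n) :
  map_mx f (krylov d A v) = krylov d (map_mx f A) (map_mx f v).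
Proof. by apply/row_matrixP=> i; rewrite -map_row !rowK map_mxM map_mxX. Qed.

(** * The transposed companion matrix as multiplication by x modulo Theta *)

Section Companion.
Variable F : fieldType.
Variable Th : {poly F}.
Hypothesis Th_monic : Th \is monic.
Local Notation d := (size Th).-1.
Local Notation N := (compmx Th)^T.

Let size_Th : size Th = d.+1.
Proof. by rewrite prednK // lt0n size_poly_eq0 monic_neq0. Qed.

(** On coefficient vectors [N] sends x^j to x^(j+1) when j+1 < d, and x^(d-1) to x^d - Th, the
    remainder of x^d modulo Th; [insub] separates the two cases. *)
Lemma row_compmxT (j : 'I_d) :
  row j N = if insub j.+1 is Some k then delta_mx 0 k
            else poly_rV ('X^d - Th).
Proof.
case: insubP => [k _ /= def_k | le_dj]; apply/rowP=> i; rewrite !mxE.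
  rewrite ifN; first by rewrite eqxx -val_eqE /= def_k.
  by apply: contraTneq (ltn_ord k) => def_j; rewrite def_k def_j -leqNgt leqSpred.
have def_d : d = j.+1 by apply/eqP; rewrite eqn_leq ltn_ord leqNgt le_dj.
rewrite -{1}[nat_of_ord j]/(j.+1.-1) -def_d eqxx.
by rewrite coefB coefXn (ltn_eqF (ltn_ord i)) sub0r.
Qed.

Let lower_size : (size ('X^d - Th)%R <= d)%N.
Proof.
apply/leq_sizeP => j; rewrite leq_eqVlt coefB coefXn => /predU1P[<-|lt_dj].
  by rewrite eqxx -[Th`_d]/(lead_coef Th) (monicP Th_monic) subrr.
by rewrite gtn_eqF // nth_default ?subrr // size_Th.
Qed.

Lemma mul_krylov_top n (A : 'M[F]_n) v :
  poly_rV ('X^d - Th) *m krylov d A v = v *m A ^+ d - v *m mxpeval A Th.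
Proof.
by rewrite mul_krylov poly_rV_K // mxpevalB mxpevalXn mulmxBr.
Qed.

(** The map f -> v f(A) turns multiplication by x into A. Reduction modulo Th occurs only in the
    last row, where Th(A) must kill v. *)
Lemma compmx_krylov n (A : 'M[F]_n) v :
  v *m mxpeval A Th = 0 -> N *m krylov d A v = krylov d A v *m A.
Proof.
move=> vTh0; apply/row_matrixP=> j; rewrite !row_mul rowK row_compmxT.
rewrite -mulmxA mulmxE -exprSr.
case: insubP => [k _ /= def_k | le_dj]; first by rewrite -rowE rowK def_k.
rewrite mul_krylov_top vTh0 subr0; congr (_ *m _ ^+ _).
by apply/eqP; rewrite eqn_leq ltn_ord andbT leqNgt.
Qed.

(** [e0] stands for the polynomial 1, so e0 N^j stands for x^j, the j-th unit vector. *)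
Lemma krylov_e0 : krylov d N (e0 F d) = 1%:M.
Proof.
apply/row_matrixP=> j; rewrite rowK rowE mulmx1.
case: j => j; elim: j => [|j IHj] lt_jd.
  by rewrite expr0 mulmx1; apply/rowP=> i; rewrite !mxE -val_eqE eqxx.
rewrite exprSr mulmxA (IHj (ltnW lt_jd)) -rowE row_compmxT insubT /=.
by congr delta_mx; apply: val_inj.
Qed.

Lemma rVpoly_compmx (c : 'rV_d) : c = e0 F d *m mxpeval N (rVpoly c).
Proof. by rewrite -mul_krylov krylov_e0 mulmx1. Qed.

Lemma e0_mxpeval_small (p : {poly F}) :
  (size p <= d)%N -> e0 F d *m mxpeval N p = poly_rV p.
Proof. by move=> le_pd; rewrite [RHS]rVpoly_compmx poly_rV_K. Qed.

(** One more step after the last row of [krylov_e0] gives e0 N^d = x^d - Th; by [mul_krylov_top]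
    this also equals e0 N^d - e0 Th(N). *)
Lemma e0_mxpeval_Th : e0 F d *m mxpeval N Th = 0.
Proof.
have [d0|d_gt0] := posnP d.
  by apply/rowP=> i; have := ltn_ord i; rewrite {2}d0.
have lt_d : (d.-1 < d)%N by rewrite prednK.
apply/eqP; rewrite -oppr_eq0 -[X in - X]addr0.
have := mul_krylov_top N (e0 F d).
have -> : e0 F d *m N ^+ d = poly_rV ('X^d - Th).
  have := congr1 (fun X => row (Ordinal lt_d) X *m N) krylov_e0.
  rewrite /= rowK rowE mulmx1 -mulmxA mulmxE -exprSr -rowE.
  rewrite row_compmxT /= prednK // => ->.
  by rewrite insubF // ltnn.
rewrite krylov_e0 mulmx1 => /eqP; rewrite -[X in X == _]addr0 (inj_eq (addrI _)) eq_sym.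
by rewrite addr0.
Qed.

(** This identifies row vectors with F[x]/(Th), p(N) acting as multiplication by p. *)
Lemma rVpoly_e0_mxpeval p : rVpoly (e0 F d *m mxpeval N p) = p %% Th.
Proof.
have lt_md : (size (p %% Th)%R <= d)%N.
  by rewrite -ltnS -size_Th ltn_modp monic_neq0.
rewrite {1}(divp_eq p Th) mxpevalD mulmxDr mulrC mxpevalM mulmxA e0_mxpeval_Th.
by rewrite mul0mx add0r e0_mxpeval_small // poly_rV_K.
Qed.

Lemma e0_mxpeval_eq0 p : (e0 F d *m mxpeval N p == 0) = (Th %| p).
Proof.
by rewrite -(can_eq rVpolyK) linear0 rVpoly_e0_mxpeval.
Qed.
End Companion.

(** * Polynomial codes as kernels of P modulo Theta *)

Section PolynomialCode.
Variable F : fieldType.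
Variables P Th : {poly F}.
Hypothesis Th_monic : Th \is monic.
Local Notation d := (size Th).-1.
Local Notation N := (compmx Th)^T.
Local Notation g := (mgcd P Th).
Local Notation h := (Th %/ mgcd P Th).

Let gcd_neq0 : gcdp P Th != 0.
Proof. by rewrite gcdp_eq0 (negPf (monic_neq0 Th_monic)) andbF. Qed.

Let lc_neq0 : (lead_coef (gcdp P Th))^-1 != 0.
Proof. by rewrite invr_eq0 lead_coef_eq0. Qed.

Lemma mgcd_monic : g \is monic.
Proof. by rewrite monicE lead_coefZ mulVf ?lead_coef_eq0. Qed.

Let eqp_mgcd : g %= gcdp P Th.
Proof. exact: eqp_scale. Qed.

Lemma mgcd_dvdl : g %| P.
Proof. by rewrite (eqp_dvdl _ eqp_mgcd) dvdp_gcdl. Qed.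

Lemma mgcd_dvdr : g %| Th.
Proof. by rewrite (eqp_dvdl _ eqp_mgcd) dvdp_gcdr. Qed.

Lemma size_mgcd_le : (size g <= size Th)%N.
Proof. exact: dvdp_leq (monic_neq0 Th_monic) mgcd_dvdr. Qed.

(** Cancelling g from Th = h g and P = P' g leaves h | f P', and h is coprime to P'. *)
Lemma dvdp_mul_mgcd f : (Th %| f * P) = (h %| f).
Proof.
rewrite -[X in X %| _ * _](divpK mgcd_dvdr) -[X in _ %| _ * X](divpK mgcd_dvdl) mulrA.
rewrite dvdp_mul2r ?(monic_neq0 mgcd_monic) //.
rewrite Gauss_dvdpl // /mgcd !divpZr ?invr_eq0 ?lead_coef_eq0 //.
rewrite (coprimepZl _ _ (invr_neq0 lc_neq0)).
rewrite (coprimepZr _ _ (invr_neq0 lc_neq0)) coprimep_sym.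
by rewrite coprimep_div_gcd // orbC monic_neq0.
Qed.

(** Since h divides Th, reduction modulo Th does not affect divisibility by h. *)
Lemma polycodeP c : polycode Th h c <-> h %| rVpoly c.
Proof.
split=> [[Q ->] | /dvdpP[Q def_c]].
  rewrite !trmx_mxpeval -mulmxA -mxpevalM rVpoly_e0_mxpeval //.
  by rewrite -dvdp_mod ?dvdp_mulIl // divp_dvd // mgcd_dvdr.
exists Q; rewrite !trmx_mxpeval -mulmxA -mxpevalM mulrC -def_c.
exact: rVpoly_compmx.
Qed.

Lemma polycode_ker c : polycode Th h c <-> c *m mxpeval N P = 0.
Proof.
rewrite [X in X *m _](rVpoly_compmx c) -mulmxA -mxpevalM.
split=> [/polycodeP | /eqP]; last first.
  by rewrite e0_mxpeval_eq0 // dvdp_mul_mgcd => /polycodeP.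
by rewrite -dvdp_mul_mgcd -(e0_mxpeval_eq0 Th_monic) => /eqP.
Qed.

Lemma polycode_rank (C : 'M_d) :
  (forall c, (c <= C)%MS <-> polycode Th h c) -> \rank C = (size g).-1.
Proof.
move=> codeC; pose k := (size g).-1.
have size_g : size g = k.+1.
  by rewrite prednK // lt0n size_poly_eq0 monic_neq0 ?mgcd_monic.
have h_neq0 : h != 0 by rewrite dvdp_div_eq0 ?mgcd_dvdr ?monic_neq0.
(* The rows of [G] stand for h, x h, ..., x^(k-1) h. They are free because Th = h g divides h u only
   if g divides u, which forces u = 0 when deg u < k. *)
pose G := krylov k N (e0 F d *m mxpeval N h).
have GE u : u *m G = e0 F d *m mxpeval N (h * rVpoly u).
  by rewrite mul_krylov mxpevalM mulmxA.
have rank_G : \rank G = k.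
  apply/eqP; rewrite -/(row_free G) -kermx_eq0; apply/rowV0P => u /sub_kermxP /eqP.
  rewrite GE e0_mxpeval_eq0 // -[X in X %| _](divpK mgcd_dvdr) dvdp_mul2l // => dvd_gu.
  apply: (can_inj rVpolyK); rewrite linear0; apply/eqP.
  apply: contraTT dvd_gu => u_neq0.
  apply/negP => /(dvdp_leq u_neq0); rewrite size_g leqNgt => /negP; apply.
  exact: size_poly.
rewrite -/k -rank_G; apply/eqP; rewrite eqn_leq !mxrankS //; apply/row_subP => i.
  apply/codeC/polycodeP; rewrite rowE GE rVpoly_e0_mxpeval //.
  by rewrite -dvdp_mod ?dvdp_mulIl // divp_dvd // mgcd_dvdr.
have /polycodeP/dvdpP[Q def_Q] : polycode Th h (row i C).
  by apply/codeC; apply: row_sub.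
(* The codeword Q h has degree < d = deg h + k, so Q has at most k coefficients. *)
have le_Qk : (size Q <= k)%N.
  have [-> | Q_neq0] := eqVneq Q 0; first by rewrite size_poly0.
  have := congr1 (fun p : {poly F} => size p) (divpK mgcd_dvdr).
  rewrite size_mul ?(monic_neq0 mgcd_monic) // size_g addnS /= => size_Th.
  have : (size (rVpoly (row i C)) <= d)%N by apply: size_poly.
  rewrite def_Q size_mul // -size_Th.
  move: (size_poly_eq0 h); rewrite (negPf h_neq0); case: (size h) => [|s] // _.
  by rewrite addnS addSn /= addnC leq_add2l.
apply/submxP; exists (poly_rV Q).
by rewrite GE poly_rV_K // mulrC -def_Q -rVpoly_compmx.
Qed.
End PolynomialCode.

(** * Rank supports, rank weights and generalized weights *)

Lemma nat_min_le (Q : nat -> Prop) w : Q w -> (nat_min Q <= w)%N.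
Proof.
rewrite /nat_min => Qw; case: pselect => [exQ|[]]; last by exists w.
by case: ex_minnP => v _; apply; apply/asboolP.
Qed.

Lemma nat_minP (Q : nat -> Prop) : (exists w, Q w) -> Q (nat_min Q).
Proof.
by rewrite /nat_min => exQ; case: pselect => // exQ'; case: ex_minnP => v /asboolP.
Qed.

Lemma submx_of_rank (F : fieldType) p n (C : 'M[F]_(p, n)) r :
  (r <= \rank C)%N -> exists2 D : 'M_n, \rank D = r & (D <= C)%MS.
Proof.
move=> le_r; exists <<pid_mx r *m row_base C : 'M_(r, n)>>%MS.
  by rewrite genmxE mxrankMfree ?row_base_free // rank_pid_mx.
by rewrite genmxE (submx_trans (submxMl _ _)) ?eq_row_base.
Qed.

Section RankWeight.
Variables (K : fieldType) (L : fieldExtType K) (B : (\dim {: L}).-tuple L).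
Hypothesis B_basis : basis_of fullv B.
Local Notation "A ^L" := (map_mx (in_alg L) A) (at level 2, format "A ^L").

Lemma MB_mulmx_map m n (c : 'rV[L]_m) (X : 'M[K]_(m, n)) :
  MB B (c *m X^L) = MB B c *m X.
Proof.
apply/matrixP=> i j; rewrite !mxE linear_sum; apply: eq_bigr => k _ /=.
by rewrite !mxE mulr_algr linearZ mulrC.
Qed.

(** If the coordinates of c factor as Y S, the row b of basis elements gives c = (b Y) S. Supports
    can thus be handled as K-subspaces extended to L. *)
Lemma MB_sub p n (c : 'rV[L]_n) (S : 'M[K]_(p, n)) :
  (MB B c <= S)%MS = (c <= S^L)%MS.
Proof.
apply/idP/submxP => [/submxP[Y def_c] | [x ->]]; last first.
  by rewrite MB_mulmx_map submxMl.
exists ((\row_i B`_i) *m Y^L); rewrite -mulmxA -map_mxM -def_c.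
apply/rowP=> j; rewrite mxE [LHS](coord_basis B_basis) ?memvf //.
by apply: eq_bigr => i _; rewrite !mxE mulr_algr.
Qed.

Lemma wtR_le p q n (D : 'M[L]_(p, n)) (S : 'M[K]_(q, n)) :
  (D <= S^L)%MS -> (wtR B D <= \rank S)%N.
Proof.
move=> DS; apply: nat_min_le; exists <<S>>%MS; split=> [|d dD].
  by rewrite genmxE.
by rewrite genmxE MB_sub (submx_trans dD).
Qed.

Lemma wtR_ex p n (D : 'M[L]_(p, n)) :
  exists2 S : 'M[K]_n, \rank S = wtR B D & (D <= S^L)%MS.
Proof.
rewrite /wtR; set Q := (X in nat_min X).
have [S [rkS suppS]] : Q (nat_min Q).
  (* The whole of K^n supports D, so the minimum is attained and is not the default 0. *)
  by apply: nat_minP; exists n, 1%:M; split=> [|d _]; rewrite ?mxrank1 ?submx1.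
by exists S => //; apply/row_subP => i; rewrite -MB_sub suppS ?row_sub.
Qed.

Section GeneralizedWeights.
Variables (p n : nat) (C : 'M[L]_(p, n)).

Lemma Mr_le q s (D : 'M[L]_(q, n)) (S : 'M[K]_(s, n)) :
  (D <= C)%MS -> (D <= S^L)%MS -> (Mr B C (\rank D) <= \rank S)%N.
Proof.
move=> DC DS; rewrite /Mr; case: eqP => // _.
apply: leq_trans (wtR_le DS); apply: nat_min_le.
(* [Mr] ranges over square matrices; [<<D>>] has the same row space as D, hence the same weight. *)
exists <<D>>%MS; rewrite !genmxE; split=> //; split=> //.
apply/eqP; rewrite eqn_leq; apply/andP; split.
  by have [S0 <- DS0] := wtR_ex D; apply: wtR_le; rewrite genmxE.
by have [S0 <-] := wtR_ex <<D>>%MS; rewrite genmxE; apply: wtR_le.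
Qed.

Lemma Mr_ex r : (r <= \rank C)%N ->
  exists (D : 'M[L]_n) (S : 'M[K]_n),
    [/\ \rank D = r, (D <= C)%MS, (D <= S^L)%MS & \rank S = Mr B C r].
Proof.
move=> le_r; have [-> | r_neq0] := eqVneq r 0%N.
  by exists 0, 0; rewrite !mxrank0 /Mr eqxx !sub0mx.
rewrite /Mr (negPf r_neq0); set Q := (X in nat_min X).
have [D [rkD [DC wtD]]] : Q (nat_min Q).
  by have [D rkD DC] := submx_of_rank le_r; apply: nat_minP; exists (wtR B D), D.
by have [S rkS DS] := wtR_ex D; exists D, S; rewrite rkS wtD.
Qed.

(** A K-subspace of dimension n - k + r, with k the dimension of C, meets C over L in dimension at
    least r; any r-dimensional part of the intersection is a witness. *)
Lemma Mr_singleton r : (r <= \rank C)%N -> (Mr B C r <= n - \rank C + r)%N.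
Proof.
move=> le_r; have le_Cn := rank_leq_col C.
have le_n : (n - \rank C + r <= n)%N by rewrite -[leqRHS](subnK le_Cn) leq_add2l.
pose S : 'M[K]_n := pid_mx (n - \rank C + r).
have rkS : \rank S = (n - \rank C + r)%N by rewrite rank_pid_mx.
have le_cap : (r <= \rank (C :&: S^L))%N.
  rewrite -(leq_add2l n).
  rewrite (leq_trans _ (leq_add (rank_leq_col (C + S^L)%MS) (leqnn _))) //.
  by rewrite mxrank_sum_cap mxrank_map rkS addnA subnKC.
have [D rkD DCS] := submx_of_rank le_cap; move: DCS; rewrite sub_capmx => /andP[DC DS].
by rewrite -rkS -rkD Mr_le.
Qed.

End GeneralizedWeights.
End RankWeight.

(** * Direct sum decompositions in coordinates *)

Section DualFrames.
Variables (F : fieldType) (I : finType) (n : nat) (d : I -> nat).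
Variables (X : forall i, 'M[F]_(d i, n)) (Y : forall i, 'M[F]_(n, d i)).

(** The rows of [X i] are a basis of the i-th summand and [Y i] reads off the coordinates in it.
    Matrix identities survive the passage from K to L. *)
Definition dual_frames :=
  [/\ forall i, X i *m Y i = 1%:M, forall i j, i != j -> X i *m Y j = 0
    & \sum_i Y i *m X i = 1%:M].

Hypothesis XY : dual_frames.

Lemma dual_frames_inj p (A : 'M_(p, n)) : (forall i, A *m Y i = 0) -> A = 0.
Proof.
case: XY => _ _ YX1 AY0; rewrite -[A]mulmx1 -YX1 mulmx_sumr big1 // => i _.
by rewrite mulmxA AY0 mul0mx.
Qed.

(** [Y i] kills every other block and inverts [X i] on its own, so the blocks are independent and
    keep their ranks. *)
Lemma mxrank_dual_sum (D : forall i, 'M[F]_(d i)) :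
  \rank (\sum_i <<D i *m X i>>)%MS = (\sum_i \rank (D i))%N.
Proof.
case: XY => XY1 XY0 _; have /mxdirectP -> : mxdirect (\sum_i <<D i *m X i>>)%MS.
  apply/mxdirect_sumsP => i _; apply/eqP/rowV0P => u.
  rewrite sub_capmx genmxE => /andP[/submxP[y def_u] u_sum].
  suffices uY0 : u *m Y i = 0.
    move: uY0; rewrite def_u mulmxA -mulmxA XY1 mulmx1 => ->; exact: mul0mx.
  apply/sub_kermxP/(submx_trans u_sum)/sumsmx_subP => j ne_ji.
  by rewrite genmxE; apply/sub_kermxP; rewrite -mulmxA XY0 ?mulmx0.
apply: eq_bigr => i _ /=; rewrite genmxE mxrankMfree // -row_leq_rank.
by rewrite -{1}(mxrank1 F (d i)) -(XY1 i) mxrankM_maxl.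
Qed.

End DualFrames.

(** * Generalized weights of a direct sum of codes *)

Section SumOfCodes.
Variables (K : fieldType) (L : fieldExtType K) (B : (\dim {: L}).-tuple L).
Hypothesis B_basis : basis_of fullv B.
Local Notation "A ^L" := (map_mx (in_alg L) A) (at level 2, format "A ^L").
Variables (I : finType) (n : nat) (d : I -> nat).
Variables (X : forall i, 'M[K]_(d i, n)) (Y : forall i, 'M[K]_(n, d i)).
Hypothesis XY : dual_frames X Y.
Variables (p : nat) (C : 'M[L]_(p, n)) (Ci : forall i, 'M[L]_(d i)).
Hypothesis projC : forall i, (C *m (Y i)^L <= Ci i)%MS.
Hypothesis injC : forall i, (Ci i *m (X i)^L <= C)%MS.

Lemma map_dual_frames : dual_frames (fun i => (X i)^L) (fun i => (Y i)^L).
Proof.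
case: XY => XY1 XY0 YX1; split=> [i | i j ne_ij |].
- by rewrite -map_mxM XY1 map_mx1.
- by rewrite -map_mxM XY0 ?map_mx0.
rewrite -(map_mx1 (in_alg L)) -YX1 raddf_sum; apply: eq_bigr => i _ /=.
by rewrite map_mxM.
Qed.

(** [projC] and [injC] together make C the direct sum of the embedded codes [Ci i]. *)
Lemma mxrank_sum_codes : \rank C = (\sum_i \rank (Ci i))%N.
Proof.
rewrite -(mxrank_dual_sum map_dual_frames); apply: eqmx_rank.
apply/andP; split; last first.
  by apply/sumsmx_subP => i _; rewrite genmxE.
case: map_dual_frames => _ _ YX1.
rewrite -[C]mulmx1 -YX1 mulmx_sumr summx_sub_sums // => i _.
by rewrite mulmxA genmxE submxMr.
Qed.

(* Peeling off the coordinate block [i] splits both the subcode and a space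
   supporting it by rank-nullity: into their projections along [Y i] and their
   intersections with the kernel of [Y i]. *)
Lemma Mr_split_ge (s : seq I) q (D : 'M[L]_(q, n)) (S : 'M[K]_n) :
    uniq s -> (D <= C)%MS -> (D <= S^L)%MS ->
    (forall i, i \notin s -> D *m (Y i)^L = 0) ->
  exists rr : I -> nat,
    [/\ \sum_(i <- s) rr i = \rank D, forall i, (rr i <= \rank (Ci i))%N
      & (\sum_(i <- s) Mr B (Ci i) (rr i) <= \rank S)%N]%N.
Proof.
elim: s q D S => [|i s IHs] q D S /= => [_ _ _ D0 | /andP[s'i s_uniq] DC DS D0].
  exists (fun=> 0%N); split=> //; rewrite !big_nil //.
  by rewrite (dual_frames_inj map_dual_frames (fun i => D0 i isT)) mxrank0.
have [||j s'j|rr [sum_rr le_rr wt_rr]] :=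
    IHs _ (D :&: kermx (Y i)^L)%MS (S :&: kermx (Y i))%MS s_uniq.
- exact: submx_trans (capmxSl _ _) DC.
- by rewrite map_capmx map_kermx capmxS.
- apply/sub_kermxP; have [-> | ne_ji] := eqVneq j i; first exact: capmxSr.
  by apply: submx_trans (capmxSl _ _) _; apply/sub_kermxP/D0; rewrite inE negb_or ne_ji.
have ne_s j : j \in s -> j != i by apply: contraTneq => ->.
(* The share of block i is the rank of the projection of D; as s has no repetition, the other shares
   are unchanged. *)
exists (fun j => if j == i then \rank (D *m (Y i)^L) else rr j); split.
- rewrite big_cons eqxx -[RHS](mxrank_mul_ker _ (Y i)^L) -sum_rr; congr (_ + _)%N.
  by apply: eq_big_seq => j /ne_s/negPf->.
- move=> j; case: eqP => // ->; rewrite mxrankS //.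
  exact: submx_trans (submxMr _ DC) (projC i).
rewrite big_cons eqxx -(mxrank_mul_ker S (Y i)) leq_add //.
  apply: Mr_le => //; first exact: submx_trans (submxMr _ DC) (projC i).
  by rewrite map_mxM submxMr.
apply: leq_trans wt_rr; rewrite leq_eqVlt; apply/orP; left; apply/eqP.
by apply: eq_big_seq => j /ne_s/negPf->.
Qed.

(** Optimal subcodes and their supports are embedded through the [X i]; dimensions add up on both
    sides. *)
Lemma Mr_sum_le (rr : I -> nat) : (forall i, rr i <= \rank (Ci i))%N ->
  (Mr B C (\sum_i rr i) <= \sum_i Mr B (Ci i) (rr i))%N.
Proof.
move=> le_rr.
have /fin_all_exists2[D /= subD] : forall i, exists2 D : 'M[L]_(d i),
  (D <= Ci i)%MS /\ \rank D = rr i &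
  exists2 S : 'M[K]_(d i), (D <= S^L)%MS & \rank S = Mr B (Ci i) (rr i).
  move=> i; have [D [S [rkD DC DS rkS]]] := Mr_ex B_basis (le_rr i).
  by exists D => //; exists S.
case/fin_all_exists2=> S DS rkS.
have <- : \rank (\sum_i <<D i *m (X i)^L>>)%MS = (\sum_i rr i)%N.
  rewrite (mxrank_dual_sum map_dual_frames).
  by apply: eq_bigr => i _; case: (subD i).
have le_S : (\rank (\sum_i <<S i *m X i>>)%MS <= \sum_i Mr B (Ci i) (rr i))%N.
  by rewrite (mxrank_dual_sum XY); apply: leq_sum => i _; rewrite rkS.
apply: leq_trans le_S; apply: Mr_le => //; apply/sumsmx_subP => i _; rewrite genmxE.
  by apply: submx_trans (injC i); rewrite submxMr //; case: (subD i).
apply: submx_trans (submxMr _ (DS i)) _; rewrite -map_mxM map_submx.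
by rewrite (sumsmx_sup i) // genmxE.
Qed.

(** Splitting an optimal subcode of C gives a distribution of r bounding the weight from below;
    [Mr_sum_le] for the same distribution gives equality. *)
Lemma Mr_sum_ex r : (r <= \rank C)%N ->
  exists rr : I -> nat, [/\ (\sum_i rr i)%N = r, forall i, (rr i <= \rank (Ci i))%N
    & Mr B C r = (\sum_i Mr B (Ci i) (rr i))%N].
Proof.
move=> le_r; have [D [S [rkD DC DS rkS]]] := Mr_ex B_basis le_r.
have [|rr [sum_rr le_rr wt_rr]] := Mr_split_ge (index_enum_uniq I) DC DS.
  by move=> i; rewrite mem_index_enum.
exists rr; rewrite -rkD; split=> //; apply/eqP; rewrite eqn_leq rkD -{2}rkS wt_rr andbT.
by rewrite -rkD -sum_rr Mr_sum_le.
Qed.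

End SumOfCodes.

(** * Coordinates adapted to a cyclic decomposition *)

(** [Y i] projects onto V_i along the other summands, then takes coordinates with respect to the
    rows of [X i]. *)
Lemma dual_frames_ex (F : fieldType) (I : finType) n (d : I -> nat)
    (V : I -> 'M[F]_n) (X : forall i, 'M_(d i, n)) :
    (\sum_i V i == 1%:M)%MS -> mxdirect (\sum_i V i) ->
    (forall i, row_free (X i)) -> (forall i, (X i :=: V i)%MS) ->
  exists Y, dual_frames X Y.
Proof.
move=> sumV dirV freeX eqXV; pose W i := (\sum_(j | j != i) V j)%MS.
have capVW i : (V i :&: W i)%MS = 0 by move/mxdirect_sumsP: dirV => /(_ i isT).
pose E i := proj_mx (V i) (W i).
have subVW i j : i != j -> (V i <= W j)%MS by move=> ne_ij; apply: (sumsmx_sup i).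
exists (fun i => E i *m pinvmx (X i)); split=> [i | i j ne_ij |].
- by rewrite mulmxA /E proj_mx_id ?eqXV // mulmxVp.
- by rewrite mulmxA /E proj_mx_0 ?mul0mx // eqXV subVW.
rewrite (eq_bigr E) => [|i _]; last first.
  by rewrite mulmxKpV // eqXV -[E i]mul1mx proj_mx_sub.
(* The projections sum to 1 because the difference kills each V_j, and these span. *)
apply/eqP; rewrite -subr_eq0 -[X in X == _]mul1mx; apply/eqP/sub_kermxP.
rewrite -(eqmxP sumV); apply/sumsmx_subP => j _; apply/sub_kermxP.
rewrite mulmxBr mulmx1 mulmx_sumr (bigD1 j) //= proj_mx_id // big1 ?addr0 ?subrr //.
by move=> i ne_ij; rewrite proj_mx_0 // subVW // eq_sym.
Qed.

(** The point is dim V = deg Th. The length d is a separate variable because it will be the degree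
    of Th lifted to L, equal but not convertible. *)
Lemma minpoly_krylov (F : fieldType) n (V A : 'M[F]_n) (Th : {poly F}) d :
    (V *m A <= V)%MS -> restr_cyclic V A -> restr_minpoly V A Th ->
    d = (size Th).-1 ->
  exists v, [/\ v *m mxpeval A Th = 0, row_free (krylov d A v)
    & (krylov d A v :=: V)%MS].
Proof.
move=> V_stable [v [vV /= [freeX /eqmxP eqXV]]] [Th_monic [VTh0 minTh]] def_d.
rewrite -/(krylov (\rank V) A v) in freeX eqXV.
have vTh0 : v *m mxpeval A Th = 0.
  by have [x ->] := submxP vV; rewrite -mulmxA VTh0 mulmx0.
suffices def_r : \rank V = d by exists v; rewrite -def_r.
have V_stableX k : (V *m A ^+ k <= V)%MS.
  elim: k => [|k IHk]; first by rewrite expr0 mulmx1.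
  by rewrite exprS -mulmxE mulmxA (submx_trans (submxMr _ V_stable)).
apply/eqP; rewrite def_d eqn_leq; apply/andP; split.
  (* If deg Th < dim V, the coefficients of Th would be a nontrivial relation between the free
     Krylov rows. *)
  rewrite leqNgt; apply/negP => lt_r.
  have le_Th : (size Th <= \rank V)%N by rewrite (leq_trans (leqSpred _)).
  have /(congr1 rVpoly) : poly_rV Th = 0 :> 'rV_(\rank V).
    by apply: (row_free_inj freeX); rewrite mul0mx mul_krylov poly_rV_K.
  rewrite poly_rV_K // linear0 => Th0.
  by have := monic_neq0 Th_monic; rewrite Th0 eqxx.
have /submxP[u def_u] : (v *m A ^+ \rank V <= krylov (\rank V) A v)%MS.
  by rewrite eqXV (submx_trans (submxMr _ vV)).
(* V is stable, so v A^(dim V) is a combination of lower powers; q is that relation. It kills v,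
   hence every v A^j, hence V, so Th divides q. *)
pose q := 'X^(\rank V) - rVpoly u.
have size_q : size q = (\rank V).+1.
  by rewrite size_polyDl size_polyXn // size_polyN ltnS size_poly.
have q_neq0 : q != 0 by rewrite -size_poly_eq0 size_q.
have : Th %| q.
  apply: minTh; have /submxP[Z ->] : (V <= krylov (\rank V) A v)%MS by rewrite eqXV.
  suffices X0 : krylov (\rank V) A v *m mxpeval A q = 0 by rewrite -mulmxA X0 mulmx0.
  apply/row_matrixP => j; rewrite row_mul rowK row0 -mulmxA.
  rewrite -(mxpeval_intertwine q (A := A)) ?mulmxE -?exprS ?exprSr // -mulmxE mulmxA.
  by rewrite mxpevalB mxpevalXn mulmxBr def_u mul_krylov subrr mul0mx.
by move/(dvdp_leq q_neq0); rewrite size_q; case: (size Th).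
Qed.

(** * Weights of ker P(M) from those of its cyclic components *)

Theorem theorem3
  (K : fieldType) (L : fieldExtType K) (n : nat)
  (n_gt0 : (0 < n)%N) (n_le_m : (n <= \dim {: L})%N)
  (B : (\dim {: L}).-tuple L) (B_basis : basis_of fullv B)
  (M : 'M[K]_n) (t : nat) (V : 'I_t -> 'M[K]_n) (Theta : 'I_t -> {poly K})
  (V_full : (\sum_(i < t) V i == 1%:M)%MS)
  (V_direct : mxdirect (\sum_(i < t) V i))
  (V_stable : forall i, (V i *m M^T <= V i)%MS)
  (V_cyclic : forall i, restr_cyclic (V i) M^T)
  (V_minpoly : forall i, restr_minpoly (V i) M^T (Theta i))
  (P : {poly L})
  (Ci : forall i : 'I_t, 'M[L]_((size (liftp L (Theta i))).-1))
  (Ci_code : forall i (c : 'rV[L]_((size (liftp L (Theta i))).-1)),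
     (c <= Ci i)%MS <->
     polycode (liftp L (Theta i))
              (liftp L (Theta i) %/ mgcd P (liftp L (Theta i))) c) :
  let C : 'M[L]_n := kermx (mxpeval (map_mx (in_alg L) M) P)^T in
  let g i := mgcd P (liftp L (Theta i)) in
  let Lam i := g i != 1 in
  let adm r (rr : 'I_t -> nat) :=
    (\sum_(i < t | Lam i) rr i)%N = r /\
    forall i, Lam i -> (rr i <= \rank (Ci i))%N in
  (* k_i = dim C_i = deg gcd(P, Theta_i) *)
  (forall i, \rank (Ci i) = (size (g i)).-1) /\
  (* M_{r_i}(C_i) <= deg Theta_i - deg gcd(P, Theta_i) + r_i *)
  (forall i (ri : nat), (1 <= ri <= \rank (Ci i))%N ->
     (Mr B (Ci i) ri <= (size (Theta i)).-1 - (size (g i)).-1 + ri)%N) /\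
  (* k = dim C = sum_{i in Lambda} deg gcd(P, Theta_i) *)
  \rank C = (\sum_(i < t | Lam i) (size (g i)).-1)%N /\
  (* M_r(C) = min (...) <= min (...) + r *)
  (forall r : nat, (1 <= r <= \rank C)%N ->
     ((exists rr, adm r rr /\
         Mr B C r = (\sum_(i < t | Lam i) Mr B (Ci i) (rr i))%N) /\
      (forall rr, adm r rr ->
         (Mr B C r <= \sum_(i < t | Lam i) Mr B (Ci i) (rr i))%N)) /\
     (forall rr, adm r rr ->
        (Mr B C r <= \sum_(i < t | Lam i && (rr i != 0%N))
                        ((size (Theta i)).-1 - (size (g i)).-1) + r)%N)) /\
  (* M_1(C) = min_{i in Lambda} M_1(C_i) *)
  ((0 < \rank C)%N ->
     (exists i, Lam i /\ Mr B C 1 = Mr B (Ci i) 1) /\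
     (forall i, Lam i -> (Mr B C 1 <= Mr B (Ci i) 1)%N)) /\
  (* M_k(C) = sum_{i in Lambda} M_{k_i}(C_i) <= sum_{i in Lambda} deg Theta_i *)
  Mr B C (\rank C) = (\sum_(i < t | Lam i) Mr B (Ci i) (\rank (Ci i)))%N /\
  (\sum_(i < t | Lam i) Mr B (Ci i) (\rank (Ci i)) <=
     \sum_(i < t | Lam i) (size (Theta i)).-1)%N.
Proof.
move=> C g Lam adm; pose f := in_alg L.
pose d i := (size (liftp L (Theta i))).-1.
have def_d i : d i = (size (Theta i)).-1 by rewrite /d size_map_poly.
have /fin_all_exists[v /all_and3[vTh0 freeX eqXV]] i :=
  minpoly_krylov (V_stable i) (V_cyclic i) (V_minpoly i) (def_d i).
have Th_monic i : liftp L (Theta i) \is monic.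
  by rewrite map_monic; case: (V_minpoly i).
have [Y XY] := dual_frames_ex V_full V_direct freeX eqXV.
pose X i := krylov (d i) M^T (v i); pose A := map_mx f M^T.
pose N i := (compmx (liftp L (Theta i)))^T.
have NX i : N i *m map_mx f (X i) = map_mx f (X i) *m A.
  by rewrite map_krylov compmx_krylov // -map_mxpeval -map_mxM vTh0 map_mx0.
have [XY1 XY0 YX1] := map_dual_frames L XY.
(* Inserting the sum of the Y_j X_j before A Y_i and moving A across X_j leaves only the term j =
   i. *)
have AY i : A *m map_mx f (Y i) = map_mx f (Y i) *m N i.
  rewrite -[LHS]mul1mx -YX1 mulmx_suml (bigD1 i) //= big1 ?addr0 => [|j ne_ji].
    by rewrite -!mulmxA [map_mx _ (X i) *m _]mulmxA -NX -[N i *m _ *m _]mulmxA XY1 mulmx1.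
  by rewrite -!mulmxA [map_mx _ (X j) *m _]mulmxA -NX -mulmxA XY0 // !mulmx0.
have in_C c : (c <= C)%MS <-> c *m mxpeval A P = 0.
  by rewrite /C trmx_mxpeval map_trmx; split=> /sub_kermxP.
have in_Ci i (c : 'rV_(d i)) : (c <= Ci i)%MS <-> c *m mxpeval (N i) P = 0.
  have kerP := polycode_ker P (Th_monic i) c.
  by split=> [/Ci_code/kerP | /kerP/Ci_code].
(* Intertwining carries ker P(A) into ker P(N_i) along [Y i], and back along [X i] in [injC]. *)
have projC i : (C *m map_mx f (Y i) <= Ci i)%MS.
  apply/row_subP => k; apply/in_Ci; rewrite row_mul -mulmxA.
  rewrite -(mxpeval_intertwine P (AY i)) mulmxA.
  by have /in_C -> := row_sub k C; rewrite mul0mx.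
have injC i : (Ci i *m map_mx f (X i) <= C)%MS.
  apply/row_subP => k; apply/in_C; rewrite row_mul -mulmxA.
  rewrite -(mxpeval_intertwine P (NX i)) mulmxA.
  by have /in_Ci -> := row_sub k (Ci i); rewrite mul0mx.
have rkCi i : \rank (Ci i) = (size (g i)).-1 by apply: polycode_rank.
(* A monic gcd is 1 exactly when its degree, here dim C_i, is 0; indices outside Lambda therefore
   carry zero codes. *)
have Lam_rk i : Lam i = (0 < \rank (Ci i))%N.
  rewrite rkCi /Lam; have := mgcd_monic P (Th_monic i); rewrite -/(g i) => g_monic.
  rewrite -[RHS]negbK -eqn0Ngt; congr (~~ _).
  apply/eqP/eqP => [-> | size_g]; first by rewrite size_poly1.
  have le_g1 : (size (g i) <= 1)%N by rewrite (leq_trans (leqSpred _)) ?size_g.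
  move: g_monic; rewrite (size1_polyC le_g1) monicE lead_coefC => /eqP->.
  exact: polyC1.
have notLam_rk i : ~~ Lam i -> \rank (Ci i) = 0%N.
  by rewrite Lam_rk lt0n negbK => /eqP.
have rkC : \rank C = (\sum_(i < t | Lam i) \rank (Ci i))%N.
  rewrite (mxrank_sum_codes XY projC injC) (bigID Lam) /=.
  by rewrite [X in (_ + X)%N]big1 ?addn0.
have Mr0 n' p (D : 'M[L]_(p, n')) : Mr B D 0 = 0%N by [].
have sing i r : (r <= \rank (Ci i))%N ->
    (Mr B (Ci i) r <= (size (Theta i)).-1 - (size (g i)).-1 + r)%N.
  by move=> le_r; rewrite -def_d -rkCi Mr_singleton.
have minC r : (r <= \rank C)%N -> exists2 rr, adm r rr &
    Mr B C r = (\sum_(i < t | Lam i) Mr B (Ci i) (rr i))%N.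
  move=> le_r; have [rr [sum_rr le_rr ->]] := Mr_sum_ex B_basis XY projC injC le_r.
  have rr0 i : ~~ Lam i -> rr i = 0%N.
    by move/notLam_rk => rk0; apply/eqP; rewrite -leqn0 -rk0.
  exists rr; first split=> //.
    by rewrite -sum_rr [LHS]big_mkcond; apply: eq_bigr => i _; case: ifPn => // /rr0->.
  by rewrite [RHS]big_mkcond; apply: eq_bigr => i _; case: ifPn => // /rr0->.
have leC r rr : adm r rr ->
    (Mr B C r <= \sum_(i < t | Lam i) Mr B (Ci i) (rr i))%N.
  (* [adm] says nothing outside Lambda, so the distribution is first reset to 0 there. *)
  case=> <- le_rr; pose rr' i := if Lam i then rr i else 0%N.
  have := Mr_sum_le B_basis XY injC (rr := rr').
  rewrite /rr' -big_mkcond => /(_ _) leC'.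
  rewrite [leqRHS]big_mkcond /= (leq_trans (leC' _)) ?leq_sum // => i *.
    by case: ifP => // /le_rr.
  by case: ifP.
split; first exact: rkCi.
split; first by move=> i r /andP[_]; apply: sing.
split; first by rewrite rkC; apply: eq_bigr => i _.
have bound rr r : adm r rr -> (Mr B C r <= \sum_(i < t | Lam i && (rr i != 0%N))
    ((size (Theta i)).-1 - (size (g i)).-1) + r)%N.
  move=> adm_r; apply: leq_trans (leC _ _ adm_r) _; case: adm_r => <- le_rr.
  (* Blocks with r_i = 0 have weight 0 and escape the Singleton term. *)
  rewrite big_mkcondr -big_split /=; apply: leq_sum => i /le_rr/sing.
  by case: eqP => // ->; rewrite Mr0.
split.
  move=> r /andP[_ le_r]; split; last by move=> rr; apply: bound.
  split; last by move=> rr; apply: leC.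
  by have [rr] := minC _ le_r; exists rr.
split.
  move=> rkC_gt0; split=> [|i Lam_i].
    have [rr [sum_rr le_rr] ->] := minC _ rkC_gt0.
    have [i Lam_i rr_i] : exists2 i, Lam i & rr i != 0%N.
      apply/exists_inP; apply: contraT => /exists_inPn rr0.
      by rewrite big1 in sum_rr => // i /rr0; rewrite negbK => /eqP.
    (* The shares sum to 1, so r_i = 1 and all others vanish. *)
    exists i; split=> //; move: sum_rr; rewrite !(bigD1 i Lam_i) /=.
    case: (rr i) rr_i => [|[|k]] // _; rewrite ?addSn // => -[] /eqP.
    rewrite sum_nat_eq0 => /forall_inP rr0.
    by rewrite big1 ?addn0 // => j /rr0/eqP ->.
  pose rr j : nat := (j == i).
  have sum1 (G : 'I_t -> nat -> nat) : (forall j, G j 0%N = 0%N) ->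
      (\sum_(j < t | Lam j) G j (rr j))%N = G i 1%N.
    move=> G0; rewrite (bigD1 i Lam_i) /= /rr eqxx.
    rewrite big1 ?addn0 // => j /andP[_ /negPf->].
    exact: G0.
  rewrite -(sum1 (fun j => Mr B (Ci j))) => [|j]; last exact: Mr0.
  apply: leC; split=> [|j Lam_j]; first exact: (sum1 (fun=> id)).
  by apply: leq_trans (leq_b1 _) _; rewrite -Lam_rk.
split; last first.
  apply: leq_sum => i _; apply: leq_trans (sing i _ (leqnn _)) _.
  (* At r_i = k_i the bound of [sing] collapses to deg Theta_i. *)
  by rewrite rkCi subnK // -def_d /d -!subn1 leq_sub2r // size_mgcd_le.
have [rr [sum_rr le_rr] ->] := minC _ (leqnn _).
apply: eq_bigr => i Lam_i; congr (Mr B _ _); apply/eqP.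
(* Shares bounded by the k_i whose sum is the sum of the k_i must all be maximal. *)
move: sum_rr; rewrite rkC => /eqP.
rewrite (leqif_sum (fun j Lj => leqif_eq (le_rr j Lj))).
by move/forall_inP/(_ i Lam_i).
Qed.
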